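(* Let $\mathcal V$ be a quantale and $\lambda$ a regular cardinal. Every lax extension $\widehat F$ to $\mathcal V\text{-}\mathsf{Rel}$ of a $\lambda$-accessible functor $F\colon\mathsf{Set}\to\mathsf{Set}$ is $\lambda$-small. In fact, $\widehat F=\widehat F^{M_\lambda}$ for $$M_\lambda=\{\text{all }\alpha\text{-ary Moss liftings of }\widehat F,\ \alpha<\lambda\}.$$
   Context: A quantale $\mathcal V$ is a complete lattice with a commutative monoid structure $(\otimes,k)$ such that each $u\otimes-$ preserves suprema; $\hom(u,-)$ denotes the right adjoint of $u\otimes -$. A $\mathcal V$-relation $r\colon X\nrightarrow Y$ is a map $X\times Y\to\mathcal V$. For $r\colon X\nrightarrow Y$, $s\colon Y\nrightarrow Z$, the composite is $(s\cdot r)(x,z)=\bigvee_{y}r(x,y)\otimes s(y,z)$; $1_X$ has value $k$ on the diagonal and $\bot$ elsewhere; $\mathcal V\text{-}\mathsf{Rel}$ is the category of sets and $\mathcal V$-relations. $\mathcal V$-relations are ordered pointwise; $r^\circ(y,x)=r(x,y)$ is the converse. A function $f\colon X\to Y$ is regarded as the $\mathcal V$-relation with value $k$ on the graph of $f$ and $\bot$ elsewhere. An element of a set $A$ is regarded as a function $1\to A$. For $q\colon Z\nrightarrow Y$ and $r\colon X\nrightarrow Y$, the lift $q\backslash r\colon X\nrightarrow Z$ is $(q\backslash r)(x,z)=\bigwedge_{y}\hom(q(z,y),r(x,y))$. A functor $F$ is $\lambda$-accessible if it preserves $\lambda$-directed colimits. A lax extension of $F$ to $\mathcal V\text{-}\mathsf{Rel}$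 is an assignment $(r\colon X\nrightarrow Y)\mapsto(\widehat Fr\colon FX\nrightarrow FY)$ such that (L1) $r\le r'$ implies $\widehat Fr\le\widehat Fr'$; (L2) $\widehat Fs\cdot\widehat Fr\le\widehat F(s\cdot r)$; (L3) $Ff\le\widehat Ff$ and $(Ff)^\circ\le\widehat F(f^\circ)$ for all functions $f$. For a cardinal $\kappa$, a $\kappa$-ary predicate lifting $\mu$ for $F$ is a family of maps sending $r\colon X\nrightarrow\kappa$ to $\mu(r)\colon FX\nrightarrow1$ with $\mu(r\cdot f)=\mu(r)\cdot Ff$ for all functions $f\colon X\to Y$ and $r\colon Y\nrightarrow\kappa$. It is monotone if $r\le r'$ implies $\mu(r)\le\mu(r')$. For $\mathfrak k\in F\kappa$, the ($\kappa$-ary) Moss lifting $\mu^{\mathfrak k}$ of $\widehat F$ is $\mu^{\mathfrak k}(f)=\mathfrak k^\circ\cdot\widehat Ff$; it is monotone. For monotone $\mu$, $\widehat F^\mu r=\bigwedge_{g\colon Y\nrightarrow\kappa}\mu(g)\backslash\mu(g\cdot r)$ for $r\colon X\nrightarrow Y$; for a class $M$ of monotone predicate liftings, the Kantorovich extension is $\widehat F^M=\bigwedge_{\mu\in M}\widehat F^\mu$. $\widehat F$ is $\lambda$-small if $\widehat F=\widehat F^M$ for some set $M$ of monotone predicate liftings each of arity $\kappa<\lambda$. *)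

(* Defs.v *)
From HB Require Import structures.
From Corelib Require Import Relation_Definitions.
From mathcomp Require Import all_boot all_order.
From mathcomp Require Import boolp classical_sets cardinality.

Set Implicit Arguments.
Unset Strict Implicit.
Unset Printing Implicit Defensive.

Import Order.TTheory.

Local Open Scope classical_set_scope.

(* One fixed universe of small sets: objects of the category Set, index posets
   of diagrams, carriers of quantales and cardinals, and index types of
   set-sized classes all live in it. *)
Definition SET := Type.

(* A complete lattice is a poset in which every subset has a supremum. *)
HB.mixin Record isQuantale d (V : Type) of Order.POrder d V := {
  qsup : set V -> V ;
  qsupP : forall A : set V, supremums A (qsup A) ;
  qmul : V -> V -> V ;
  qunit : V ;
  qmulA : associative qmul ;
  qmulC : commutative qmul ;
  qmul1 : left_id qunit qmul ;
  qmul_sup : forall (u : V) (A : set V), qmul u (qsup A) = qsup (qmul u @` A)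
}.

#[short(type="quantaleType")]
HB.structure Definition Quantale d := { V of isQuantale d V & Order.POrder d V }.

Section QuantaleTheory.
Context {d : Order.disp_t} {V : quantaleType d}.
Implicit Types (u v w : V) (A : set V).

Definition qinf A : V := qsup (lbound A).

Definition qbot : V := qsup set0.

Definition qhom u w : V := qsup [set v | (qmul u v <= w)%O].

Lemma qsup_ub A v : A v -> (v <= qsup A)%O.
Proof. by have [ub _] := qsupP A; exact: ub. Qed.

Lemma qsup_le A w : (forall v, A v -> (v <= w)%O) -> (qsup A <= w)%O.
Proof. by have [_ lub] := qsupP A => Aw; exact: lub. Qed.

Lemma qinf_lb A v : A v -> (qinf A <= v)%O.
Proof. by move=> Av; apply: qsup_le => w; exact. Qed.

Lemma qinf_ge A w : (forall v, A v -> (w <= v)%O) -> (w <= qinf A)%O.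
Proof. by move=> Aw; exact: qsup_ub. Qed.

Lemma qbot_le v : (qbot <= v)%O.
Proof. by apply: qsup_le. Qed.

Lemma qmul_le2l u v w : (v <= w)%O -> (qmul u v <= qmul u w)%O.
Proof.
move=> vw; have -> : w = qsup [set v; w].
  apply/le_anti/andP; split; first by apply: qsup_ub; right.
  by apply: qsup_le => _ [] ->.
by rewrite qmul_sup; apply: qsup_ub; exists v => //; left.
Qed.

Lemma qmul_le2 u u' v v' :
  (u <= u')%O -> (v <= v')%O -> (qmul u v <= qmul u' v')%O.
Proof.
move=> uu' vv'; apply: le_trans (qmul_le2l _ vv') _.
by rewrite ![qmul _ v']qmulC; exact: qmul_le2l.
Qed.

Lemma qmul0 u : qmul u qbot = qbot.
Proof. by rewrite qmul_sup image_set0. Qed.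

Lemma qhomP u v w : (qmul u v <= w)%O <-> (v <= qhom u w)%O.
Proof.
split=> [uvw|/(qmul_le2l u)/le_trans]; first exact: qsup_ub.
by apply; rewrite qmul_sup; apply: qsup_le => _ [v' + <-].
Qed.

End QuantaleTheory.

Definition vrel d (V : quantaleType d) (X Y : SET) : SET := X -> Y -> V.

Section VRelations.
Context {d : Order.disp_t} {V : quantaleType d}.

Definition vle (X Y : SET) (r s : vrel V X Y) : Prop :=
  forall x y, (r x y <= s x y)%O.

(* [vcomp s r] is the composite "s after r". *)
Definition vcomp (X Y Z : SET) (s : vrel V Y Z) (r : vrel V X Y) : vrel V X Z :=
  fun x z => qsup (range (fun y => qmul (r x y) (s y z))).

Definition vconv (X Y : SET) (r : vrel V X Y) : vrel V Y X := fun y x => r x y.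

Definition vgraph (X Y : SET) (f : X -> Y) : vrel V X Y :=
  fun x y => if `[< f x = y >] then qunit else qbot.

Definition vlift (X Y Z : SET) (q : vrel V Z Y) (r : vrel V X Y) : vrel V X Z :=
  fun x z => qinf (range (fun y => qhom (q z y) (r x y))).

End VRelations.

Notation "r <=V s" := (vle r s) (at level 70, no associativity).
Notation "s \oV r" := (vcomp s r) (at level 50, left associativity).
Notation "r ^oV" := (vconv r) (at level 2, left associativity, format "r ^oV").
Notation "q \\V r" := (vlift q r) (at level 50, left associativity).

Section VRelationsTheory.
Context {d : Order.disp_t} {V : quantaleType d}.

Lemma vle_anti (X Y : SET) (r s : vrel V X Y) : r <=V s -> s <=V r -> r = s.
Proof.
by move=> rs sr; apply/funext=> x; apply/funext=> y; apply/le_anti/andP; split.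
Qed.

Lemma vle_trans (X Y : SET) (s r t : vrel V X Y) :
  r <=V s -> s <=V t -> r <=V t.
Proof. by move=> rs st x y; exact: le_trans (rs x y) (st x y). Qed.

Lemma vcomp_le (X Y Z : SET) (s s' : vrel V Y Z) (r r' : vrel V X Y) :
  s <=V s' -> r <=V r' -> s \oV r <=V s' \oV r'.
Proof.
move=> ss' rr' x z; apply: qsup_le => _ [y _ <-].
by apply: le_trans (qmul_le2 (rr' x y) (ss' y z)) _; apply: qsup_ub; exists y.
Qed.

Lemma vcomp_graphr (X Y Z : SET) (r : vrel V Y Z) (f : X -> Y) :
  r \oV vgraph f = fun x z => r (f x) z.
Proof.
apply: vle_anti => x z; last first.
  apply: qsup_ub; exists (f x) => //; rewrite /vgraph.
  by case: asboolP => // _; rewrite qmul1.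
apply: qsup_le => _ [y _ <-]; rewrite /vgraph; case: asboolP => [<-|_].
  by rewrite qmul1.
by rewrite qmulC qmul0; exact: qbot_le.
Qed.

Lemma vcomp_convgraphl (X Y Z : SET) (f : Z -> Y) (r : vrel V X Y) :
  (vgraph f)^oV \oV r = fun x z => r x (f z).
Proof.
apply: vle_anti => x z; last first.
  apply: qsup_ub; exists (f z) => //; rewrite /vconv /vgraph.
  by case: asboolP => // _; rewrite qmulC qmul1.
apply: qsup_le => _ [y _ <-]; rewrite /vconv /vgraph; case: asboolP => [<-|_].
  by rewrite qmulC qmul1.
by rewrite qmul0; exact: qbot_le.
Qed.

End VRelationsTheory.

Record functor := Functor {
  fobj :> SET -> SET ;
  fmor : forall X Y : SET, (X -> Y) -> fobj X -> fobj Y ;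
  fmor_id : forall X : SET, fmor (@id X) = id ;
  fmor_comp : forall (X Y Z : SET) (g : Y -> Z) (f : X -> Y),
    fmor (g \o f) = fmor g \o fmor f
}.

Arguments fmor F {X Y} f : rename.

Definition card_lt (T U : Type) (A : set T) (B : set U) : bool :=
  (A #<= B)%card && ~~ (B #<= A)%card.

(* Cardinals are initial ordinals: a cardinal is a well-ordered set that is
   not equinumerous to any of its proper initial segments.  An element of a
   well-ordered set stands for the ordinal given by the segment below it, so
   that, as for von Neumann ordinals, the cardinals smaller than the cardinal L
   are exactly those elements of L whose segment is again a cardinal. *)
Section Cardinals.
Context {e : Order.disp_t} (L : orderType e).

Definition segment (a : L) : SET := {b : L | (b < a)%O}.

Definition cardinal : Prop :=
  well_founded (fun a b : L => (a < b)%O) /\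
  forall a : L, card_lt [set b | (b < a)%O] [set: L].

Definition regular_cardinal : Prop :=
  [/\ cardinal,
      infinite_set [set: L]
    & forall A : set L, card_lt A [set: L] -> exists a, forall b, A b -> (b < a)%O].

Definition segment_cardinal (a : L) : Prop :=
  forall b : L, (b < a)%O ->
    card_lt [set c | (c < b)%O] [set c | (c < a)%O].

Definition card_below : SET := {a : L | segment_cardinal a}.

Definition card_below_set (k : card_below) : SET := segment (sval k).

End Cardinals.

(* Diagrams of sets indexed by a poset; [dmap_comp] also makes the transition
   maps independent of the proof of [le i j]. *)
Record diagram (I : SET) (le : relation I) := Diagram {
  dobj :> I -> SET ;
  dmap : forall i j, le i j -> dobj i -> dobj j ;
  dmap_id : forall i (h : le i i), dmap h = id ;
  dmap_comp : forall i j k (hij : le i j) (hjk : le j k) (hik : le i k),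
    dmap hik = dmap hjk \o dmap hij
}.

Arguments dmap {I le} D {i j} h : rename.

Definition cocone (I : SET) (le : relation I) (D : diagram le)
    (C : SET) (c : forall i, D i -> C) : Prop :=
  forall i j (h : le i j), c j \o dmap D h = c i.

Definition is_colimit (I : SET) (le : relation I) (D : diagram le)
    (C : SET) (c : forall i, D i -> C) : Prop :=
  cocone c /\
  forall (T : SET) (t : forall i, D i -> T), cocone t ->
    exists! u : C -> T, forall i, u \o c i = t i.

Section FunctorDiagram.
Context (F : functor) (I : SET) (le : relation I) (D : diagram le).

Let fdob (i : I) : SET := F (D i).
Let fdmap i j (h : le i j) : fdob i -> fdob j := fmor F (dmap D h).

Let fdmap_id i (h : le i i) : fdmap h = id.
Proof. by rewrite /fdmap dmap_id fmor_id. Qed.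

Let fdmap_comp i j k (hij : le i j) (hjk : le j k) (hik : le i k) :
  fdmap hik = fdmap hjk \o fdmap hij.
Proof. by rewrite /fdmap (dmap_comp D hij hjk hik) fmor_comp. Qed.

Definition fdiagram : diagram le := Diagram fdmap_id fdmap_comp.

End FunctorDiagram.

Section Accessible.
Context {e : Order.disp_t} (L : orderType e).

Definition directed (I : SET) (le : relation I) : Prop :=
  forall A : set I, card_lt A [set: L] -> exists j, forall i, A i -> le i j.

Definition accessible (F : functor) : Prop :=
  forall (I : SET) (le : relation I), Relation_Definitions.order I le -> directed le ->
  forall (D : diagram le) (C : SET) (c : forall i, D i -> C),
    is_colimit c -> is_colimit (D := fdiagram F D) (fun i => fmor F (c i)).

End Accessible.

Record lax_extension d (V : quantaleType d) (F : functor) := LaxExtension {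
  lax :> forall X Y : SET, vrel V X Y -> vrel V (F X) (F Y) ;
  lax_le : forall (X Y : SET) (r r' : vrel V X Y),
    r <=V r' -> lax r <=V lax r' ;
  lax_comp : forall (X Y Z : SET) (r : vrel V X Y) (s : vrel V Y Z),
    lax s \oV lax r <=V lax (s \oV r) ;
  lax_graph : forall (X Y : SET) (f : X -> Y),
    vgraph (fmor F f) <=V lax (vgraph f) ;
  lax_conv : forall (X Y : SET) (f : X -> Y),
    (vgraph (fmor F f))^oV <=V lax ((vgraph f)^oV)
}.

Record predicate_lifting d (V : quantaleType d) (F : functor) (K : SET) :=
  PredicateLifting {
    plift :> forall X : SET, vrel V X K -> vrel V (F X) unit ;
    plift_nat : forall (X Y : SET) (f : X -> Y) (r : vrel V Y K),
      plift (r \oV vgraph f) = plift r \oV vgraph (fmor F f)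
  }.

Section Kantorovich.
Context {d : Order.disp_t} {V : quantaleType d} {F : functor}.

Definition monotone_lifting (K : SET) (m : predicate_lifting V F K) : Prop :=
  forall (X : SET) (r r' : vrel V X K), r <=V r' -> m X r <=V m X r'.

Definition kantorovich1 (K : SET) (m : predicate_lifting V F K)
    (X Y : SET) (r : vrel V X Y) : vrel V (F X) (F Y) :=
  fun a b => qinf (range (fun g : vrel V Y K => (m Y g \\V m X (g \oV r)) a b)).

(* Predicate liftings of arbitrary arity form a proper class; a class of
   them is a predicate on [lifting] and need not be set-sized. *)
Definition lifting := {K : SET & predicate_lifting V F K}.

Definition lifting_class := lifting -> Prop.

Definition kantorovich (M : lifting_class)
    (X Y : SET) (r : vrel V X Y) : vrel V (F X) (F Y) :=
  fun a b => qinf [set v | exists m, M m /\ v = kantorovich1 (projT2 m) r a b].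

Definition is_set (M : lifting_class) : Prop :=
  exists (I : SET) (m : I -> lifting), forall n, M n <-> exists i, m i = n.

End Kantorovich.

Arguments lifting {d} V F.
Arguments lifting_class {d} V F.

Section Small.
Context {d : Order.disp_t} {V : quantaleType d} {F : functor}.
Variable Fh : lax_extension V F.

Lemma lax_nat (X Y Z : SET) (f : X -> Y) (r : vrel V Y Z) :
  Fh X Z (r \oV vgraph f) = Fh Y Z r \oV vgraph (fmor F f).
Proof.
apply: vle_anti; last first.
  apply: vle_trans (lax_comp Fh (vgraph f) r).
  by apply: vcomp_le; [move=> ? ?; exact: lexx|exact: lax_graph].
set s := r \oV vgraph f.
have sr : s \oV (vgraph f)^oV <=V r.
  move=> y z; apply: qsup_le => _ [x _ <-].
  rewrite /s vcomp_graphr /vconv /vgraph; case: asboolP => [<-|_].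
    by rewrite qmul1.
  by rewrite qmulC qmul0; exact: qbot_le.
apply: (@vle_trans _ _ _ _
  ((Fh _ _ s \oV (vgraph (fmor F f))^oV) \oV vgraph (fmor F f))).
  move=> a c; rewrite vcomp_graphr; apply: qsup_ub; exists a => //.
  by rewrite /vconv /vgraph; case: asboolP => // _; rewrite qmul1.
apply: vcomp_le => [|? ?]; last exact: lexx.
apply: vle_trans (lax_le Fh sr); apply: vle_trans (lax_comp Fh _ _).
by apply: vcomp_le => [? ?|]; [exact: lexx|exact: lax_conv].
Qed.

Definition moss_map (K : SET) (k : F K) (X : SET) (r : vrel V X K) :
    vrel V (F X) unit :=
  (vgraph (fun _ : unit => k))^oV \oV Fh X K r.

Lemma moss_nat (K : SET) (k : F K) (X Y : SET) (f : X -> Y) (r : vrel V Y K) :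
  moss_map k (r \oV vgraph f) = moss_map k r \oV vgraph (fmor F f).
Proof. by rewrite /moss_map lax_nat !vcomp_convgraphl !vcomp_graphr. Qed.

Definition moss (K : SET) (k : F K) : predicate_lifting V F K :=
  PredicateLifting (moss_nat k).

Context {e : Order.disp_t} (L : orderType e).

Definition arity_below (m : lifting V F) : Prop :=
  exists kappa : card_below L, projT1 m = card_below_set kappa.

Definition lambda_small : Prop :=
  exists M : lifting_class V F,
    [/\ is_set M,
        forall m, M m -> monotone_lifting (projT2 m) /\ arity_below m
      & forall (X Y : SET) (r : vrel V X Y), Fh X Y r = kantorovich M r].

Definition moss_liftings : lifting_class V F :=
  fun m => exists (alpha : card_below L) (k : F (card_below_set alpha)),
    m = existT _ _ (moss k).

End Small.

(* Main.v *)
Require Import Defs.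
From mathcomp Require Import all_boot all_order.
From mathcomp Require Import boolp classical_sets functions cardinality.

(** The inequality from the lax extension to the Kantorovich extension holds for
Moss liftings of every arity: by the adjunction defining the residual it says
that the values of the extension at [r] and at [g] multiply into its value at
[g \oV r], which is lax functoriality ([lax_le_kantorovich_moss]).

Conversely, fix [a] in [F X] and [b] in [F Y].  If [b = fmor F g k] for some
[g : K -> Y] and [k : F K], then already the Moss lifting at [k], tested on the
relation [(vgraph g)^oV], bounds the Kantorovich extension by the value of the
lax extension at [(a, b)] ([kantorovich_moss_le_lax]).  So it remains to write
every [b] in this form with [K] a cardinal below [L]; this is where
accessibility enters ([accessible_factor]).  The set [Y] is the colimit of its
subsets of cardinality below [L], and regularity makes this diagram directed
([small_bigcup]); [F] preserves the colimit, and the legs of a colimit in sets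
are jointly surjective, so [b] comes from a small subset of [Y], which is then
replaced by a cardinal ([small_factor]). *)

Set Implicit Arguments.
Unset Strict Implicit.
Unset Printing Implicit Defensive.

Import Order.TTheory.

Local Open Scope classical_set_scope.

(** * Sets of cardinality below a regular cardinal *)

Section SmallSets.
Context {e : Order.disp_t} (L : orderType e).

(** Over a well-order [L] this is [card_lt A [set: L]], by comparability of
[A] and [L].  The negative form makes closure properties provable by
contradiction from an injection of [L] into [A], and comparability is used only
once, in [small_le_segment]. *)
Definition small (T : Type) (A : set T) : Prop := ~ ([set: L] #<= A)%card.

Lemma inj_not_small (T : Type) (A : set T) (f : L -> T) :
  injective f -> (forall l, A (f l)) -> ~ small A.
Proof.
move=> finj fA; apply.
have := @inj_card_eq _ _ [set: L] f (in2W finj).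
move=> /card_eqPle[_ /card_le_trans]; apply.
by apply: subset_card_le => _ [l _ <-].
Qed.

Lemma not_small_inj (T : Type) (A : set T) :
  ~ small A -> exists2 f : L -> T, injective f & forall l, A (f l).
Proof.
move=> /contrapT/card_leP[f].
exists (fun l => val (f (SigSub (mem_set (I : [set: L] l))))).
  move=> a b /val_inj.
  by move/(@inj _ _ _ f _ _ (in_setT _) (in_setT _))/(congr1 val).
by move=> l; apply: set_mem; exact: valP.
Qed.

Lemma small_card_lt (T : Type) (A : set T) :
  card_lt A [set: L] -> small A.
Proof. by case/andP=> _ /negP. Qed.

Lemma card_lt_small (A : set L) : small A -> card_lt A [set: L].
Proof. by move=> sA; rewrite /card_lt card_leT; exact/negP. Qed.

Lemma small_le (T U : Type) (A : set T) (B : set U) :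
  (A #<= B)%card -> small B -> small A.
Proof. by move=> AB sB LA; apply: sB; exact: card_le_trans AB. Qed.

Lemma wf_minimal (P : L -> Prop) :
    well_founded (fun a b : L => (a < b)%O) ->
  (exists a, P a) -> exists2 a, P a & forall b, (b < a)%O -> ~ P b.
Proof.
move=> wf [a]; elim/(well_founded_ind wf): a => a IH Pa.
have [[b [ba Pb]]|no] := pselect (exists b, (b < a)%O /\ P b).
  exact: IH Pb.
by exists a => // b ba Pb; apply: no; exists b.
Qed.

(** Enumerate [A] without repetition by transfinite recursion along [L]: the
value at [a] is an element of [A] not met below [a].  If this never stopped,
it would inject [L] into [A]; where it stops, the segment covers [A]. *)
Lemma small_le_segment (T : Type) (A : set T) :
    well_founded (fun a b : L => (a < b)%O) -> small A ->
  exists a : L, (A #<= [set b | (b < a)%O])%card.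
Proof.
move=> wf sA; have [[x0 Ax0]|A0] := pselect (A !=set0); last first.
  have [[a _]|L0] := pselect (exists a : L, True).
    exists a; suff -> : A = set0 by exact: card_ge0.
    by apply/eqP; apply: contra_notT A0 => /set0P.
  case: sA; suff -> : [set: L] = set0 by exact: card_ge0.
  by apply/seteqP; split=> // a _; apply: L0; exists a.
(* The default value [x0] is taken only once [A] is exhausted. *)
pose fresh (a : L) (h : forall b, (b < a)%O -> T) (x : T) :=
  A x /\ forall b ba, h b ba <> x.
pose step a h := if pselect (exists x, fresh a h x) is left hx
  then sval (cid hx) else x0.
pose h := Fix wf (fun=> T) step.
have hE a : h a = step a (fun b _ => h b).
  rewrite /h Fix_eq // => {}a f g fg; congr step.
  by apply: functional_extensionality_dep => b; apply: functional_extensionality_dep => ba.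
apply: contrapT => noseg.
have hfresh a : fresh a (fun b _ => h b) (h a).
  rewrite hE /step; case: pselect => [hx|nofresh]; first exact: (svalP (cid hx)).
  case: noseg; exists a.
  apply: card_le_trans (card_image_le h _); apply: subset_card_le => x Ax.
  apply: contrapT => hx; apply: nofresh; exists x; split=> // b ba hb.
  by apply: hx; exists b.
apply: (@inj_not_small _ A h) sA; last by move=> a; case: (hfresh a).
move=> a b hab; case: (ltgtP a b) => // [ab|ba].
  by case: (hfresh b) => _ /(_ a ab).
by case: (hfresh a) => _ /(_ b ba); rewrite hab.
Qed.

(** If [f] injected [L] into the union, then by
regularity each preimage of [A i] would have a strict upper bound [c i], and
the [c i] would have a strict upper bound [z]; but [f z] lies in some [A i],
so that [z < c i < z]. *)
Lemma small_bigcup (I T : Type) (J : set I) (A : I -> set T) :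
    regular_cardinal L -> small J -> (forall i, J i -> small (A i)) ->
  small (\bigcup_(i in J) A i).
Proof.
move=> [_ _ reg] sJ sA; apply: contrapT => /not_small_inj[f finj fU].
have bnd i : exists c, J i -> forall l, A i (f l) -> (l < c)%O.
  have [Ji|nJi] := pselect (J i); last first.
    have [|c _] := reg set0; last by exists c.
    by apply: card_lt_small; exact: small_le (card_ge0 _ _) sJ.
  have [|c cP] := reg [set l | A i (f l)]; last by exists c.
  apply: card_lt_small; apply: small_le (sA _ Ji).
  by apply: (@card_ge_preimage _ _ (A i) f); exact: in2W.
have [c cP] := choice bnd.
have [|z zP] := reg (c @` J).
  by apply: card_lt_small; exact: small_le (card_image_le _ _) sJ.
have [i Ji Aifz] := fU z.
have := lt_trans (cP i Ji z Aifz) (zP _ (imageP c Ji)).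
by rewrite ltxx.
Qed.

Lemma small_set1 (T : Type) (x : T) :
  infinite_set [set: L] -> small [set x].
Proof. by move=> Linf Lx; apply: Linf; exact: card_le_finite Lx (finite_set1 x). Qed.

(** The least segment into which [A] injects is a cardinal.  A retraction [g]
onto [A] needs values outside the image of [A] too; minimality provides them,
because the empty set injects into every segment, so that [A] can only be empty
when the least segment is. *)
Lemma small_factor (T : Type) (A : set T) :
    well_founded (fun a b : L => (a < b)%O) -> small A ->
  exists (alpha : card_below L) (i : A -> card_below_set alpha)
    (g : card_below_set alpha -> T), forall x, g (i x) = val x.
Proof.
move=> wf /(small_le_segment wf)/(wf_minimal wf)[a Aa amin].
have acard : segment_cardinal a.
  move=> b ba; apply/andP; split.
    by apply: subset_card_le => c /= /lt_trans; apply.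
  by apply/negP => ab; apply: amin ba _; exact: card_le_trans ab.
have [f] := card_leP Aa.
pose i (x : A) : segment a := exist _ (val (f x)) (set_mem (valP (f x))).
have iinj x y : i x = i y -> x = y.
  move=> /(congr1 sval)/= /val_inj.
  by move/(@inj _ _ _ f _ _ (in_setT _) (in_setT _)).
have /choice[g gP] : forall z : segment a, exists y, forall x, i x = z -> y = val x.
  move=> z; have [[x xz]|noz] := pselect (exists x, i x = z).
    by exists (val x) => x'; rewrite -xz => /iinj ->.
  have [[y _]|A0] := pselect (A !=set0).
    by exists y => x xz; case: noz; exists x.
  case: (amin _ (svalP z)); suff -> : A = set0 by exact: card_ge0.
  by apply/eqP; apply: contra_notT A0 => /set0P.
by exists (exist _ a acard), i, g => x; exact: gP.
Qed.

End SmallSets.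

(** * Elements of an accessible functor are supported on small subsets *)

(** The legs are jointly surjective because the indicator of their joint image
and the constant [true] agree on every leg, hence are equal. *)
Lemma colimit_surjective (I : SET) (le : Relation_Definitions.relation I) (D : diagram le)
    (C : SET) (c : forall i, D i -> C) :
  is_colimit c -> forall y, exists i x, c i x = y.
Proof.
move=> [cc univ] y.
have [|u [_ uniq]] := univ bool (fun i _ => true); first by [].
have := uniq (fun=> true) (fun=> erefl).
rewrite (uniq (fun z => `[< exists i x, c i x = z >])).
  by move/(congr1 (fun v => v y)) => /asboolP.
move=> i; apply/funext => x /=; by apply/asboolP; exists i, x.
Qed.

Section SmallSubsets.
Context {e : Order.disp_t} (L : orderType e) (Y : SET).

Definition small_subset : SET := {A : set Y | small L A}.

Definition small_subset_le : Relation_Definitions.relation small_subset :=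
  fun A B => sval A `<=` sval B.

Lemma small_subset_order : Relation_Definitions.order small_subset small_subset_le.
Proof.
split; [by move=> A | by move=> B A C; exact: subset_trans |].
move=> [A sA] [B sB] /= AB BA; have AB' : A = B by exact/seteqP.
by rewrite {}AB' in sA AB BA *; congr exist; exact: Prop_irrelevance.
Qed.

Definition small_subset_diagram : diagram small_subset_le.
Proof.
apply: (@Diagram _ small_subset_le (fun A => set_type (sval A))
  (fun A B AB => subfun AB)).
- by move=> A h; apply/funext => x; exact: val_inj.
- by move=> A B C AB BC AC; apply/funext => x; exact: val_inj.
Defined.

Lemma small_subset_directed :
  regular_cardinal L -> directed L small_subset_le.
Proof.
move=> reg J /small_card_lt sJ.
have sU : small L (\bigcup_(A in J) sval A).
  by apply: small_bigcup => // A _; exact: svalP.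
by exists (exist _ _ sU) => A JA y Ay; exists A.
Qed.

(** A compatible family of functions on the small subsets is determined by its
values on singletons, which are small because [L] is infinite. *)
Lemma small_subset_colimit : infinite_set [set: L] ->
  is_colimit (D := small_subset_diagram) (fun A (x : set_type (sval A)) => val x).
Proof.
move=> Linf; split=> [A B AB|T t tc]; first exact/funext.
pose pt y : small_subset := exist _ [set y] (@small_set1 _ L Y y Linf).
pose inpt y : small_subset_diagram (pt y) := SigSub (mem_set (erefl y)).
exists (fun y => t (pt y) (inpt y)); split.
  move=> A; apply/funext => x /=.
  have xA : small_subset_le (pt (val x)) A by move=> _ ->; exact: set_mem (valP x).
  rewrite -(tc _ _ xA) /=; congr t; exact: val_inj.
by move=> u uP; apply/funext => y; rewrite -uP.
Qed.

End SmallSubsets.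

(** [F] preserves the colimit of the small subsets of [Y], so [b] is the image of
some [x : F A] with [A] small; transporting [x] along an injection of [A] into a
cardinal gives [k]. *)
Lemma accessible_factor {e : Order.disp_t} (L : orderType e) (F : functor)
    (Y : SET) (b : F Y) :
    regular_cardinal L -> accessible L F ->
  exists (alpha : card_below L) (k : F (card_below_set alpha))
    (g : card_below_set alpha -> Y), fmor F g k = b.
Proof.
move=> reg acc; have [[wf _] Linf _] := reg.
have := acc _ _ (small_subset_order L Y) (small_subset_directed reg)
  _ _ _ (small_subset_colimit Y Linf).
move=> /colimit_surjective/(_ b)[A [x <-]].
have [alpha [i [g gi]]] := small_factor wf (svalP A).
exists alpha, (fmor F i x), g.
rewrite -[LHS]/((fmor F g \o fmor F i) x) -fmor_comp.
by congr (fmor F _ x); apply/funext => z; exact: gi.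
Qed.

(** * The Kantorovich extension of a Moss lifting *)

Section Moss.
Context {d : Order.disp_t} {V : quantaleType d} {F : functor}.
Variable Fh : lax_extension V F.

Lemma mossE (K : SET) (k : F K) (X : SET) (r : vrel V X K) a u :
  moss Fh k X r a u = Fh X K r a k.
Proof. by rewrite /= /moss_map vcomp_convgraphl. Qed.

Lemma moss_monotone (K : SET) (k : F K) : monotone_lifting (moss Fh k).
Proof. by move=> X r r' rr' a u; rewrite !mossE; exact: lax_le. Qed.

Lemma lax_compE (X Y Z : SET) (r : vrel V X Y) (s : vrel V Y Z) a b c :
  (qmul (Fh X Y r a b) (Fh Y Z s b c) <= Fh X Z (s \oV r) a c)%O.
Proof. by apply: le_trans (lax_comp Fh r s a c); apply: qsup_ub; exists b. Qed.

Lemma lax_graph_unit (X Y : SET) (f : X -> Y) a :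
  (qunit <= Fh X Y (vgraph f) a (fmor F f a))%O.
Proof.
by apply: le_trans (lax_graph Fh f a _); rewrite /vgraph asboolT.
Qed.

Lemma lax_conv_unit (X Y : SET) (f : X -> Y) a :
  (qunit <= Fh Y X (vgraph f)^oV (fmor F f a) a)%O.
Proof.
by apply: le_trans (lax_conv Fh f _ a); rewrite /vconv /vgraph asboolT.
Qed.

(** After transposing along the residual, the inequality for the test relation
[g] is [lax_compE] at the middle point [b]. *)
Lemma lax_le_kantorovich_moss (K : SET) (k : F K) (X Y : SET) (r : vrel V X Y) :
  Fh X Y r <=V kantorovich1 (moss Fh k) r.
Proof.
move=> a b; apply: qinf_ge => _ [g _ <-]; apply: qinf_ge => _ [u _ <-].
by apply/qhomP; rewrite !mossE qmulC; exact: lax_compE.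
Qed.

(** Test with the relation [(vgraph g)^oV]: its extension relates [fmor F g k] to
[k] with value at least the unit, so the residual is at most the extension of
[s := (vgraph g)^oV \oV r] at [(a, k)].  Composing with [g] returns to
[fmor F g k], and [vgraph g \oV s] lies below [r]. *)
Lemma kantorovich_moss_le_lax (K : SET) (k : F K) (X Y : SET) (r : vrel V X Y)
    (g : K -> Y) a :
  (kantorovich1 (moss Fh k) r a (fmor F g k) <= Fh X Y r a (fmor F g k))%O.
Proof.
apply: le_trans (qinf_lb (imageP _ (I : [set: vrel V Y K] (vgraph g)^oV))) _.
apply: le_trans (qinf_lb (imageP _ (I : [set: unit] tt))) _.
rewrite !mossE.
set s := (vgraph g)^oV \oV r.
have sr : vgraph g \oV s <=V r.
  move=> x y; rewrite /s vcomp_convgraphl; apply: qsup_le => _ [z _ <-].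
  rewrite /vgraph; case: asboolP => [->|_]; first by rewrite qmulC qmul1.
  by rewrite qmul0; exact: qbot_le.
apply: le_trans (lax_le Fh sr a _).
apply: le_trans (lax_compE s (vgraph g) a k _).
set h := qhom _ _.
have hs : (h <= Fh X K s a k)%O.
  rewrite -[h]qmul1; apply: le_trans (qmul_le2 (lax_conv_unit g k) (lexx h)) _.
  by apply/qhomP.
(* The value of [h] is multiplied by the unit to make room for the factor of [g]. *)
rewrite -[h]qmul1 qmulC; apply: qmul_le2 hs _; exact: lax_graph_unit.
Qed.

End Moss.

Theorem proposition5p5
  (d : Order.disp_t) (V : quantaleType d)
  (e : Order.disp_t) (L : orderType e) (hL : regular_cardinal L)
  (F : functor) (hF : accessible L F)
  (Fh : lax_extension V F) :
  lambda_small Fh L /\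
  (forall (X Y : SET) (r : vrel V X Y),
     Fh X Y r = kantorovich (moss_liftings Fh L) r).
Proof.
have main (X Y : SET) (r : vrel V X Y) :
    Fh X Y r = kantorovich (moss_liftings Fh L) r.
  apply: vle_anti => a b.
    apply: qinf_ge => _ [_ [[alpha [k ->]] ->]].
    exact: lax_le_kantorovich_moss.
  have [alpha [k [g <-]]] := accessible_factor b hL hF.
  apply: le_trans (kantorovich_moss_le_lax Fh k r g a).
  by apply: qinf_lb; exists (existT _ _ (moss Fh k)); split=> //; exists alpha, k.
split=> //; exists (moss_liftings Fh L); split=> //.
- exists {alpha : card_below L & F (card_below_set alpha)}.
  exists (fun p : {alpha : card_below L & F (card_below_set alpha)} =>
    existT _ _ (moss Fh (projT2 p))) => m; split.
    by move=> [alpha [k ->]]; exists (existT _ alpha k).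
  by move=> [[alpha k] <-]; exists alpha, k.
- move=> _ [alpha [k ->]]; split; first exact: moss_monotone.
  by exists alpha.
Qed.
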